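(* If $\lambda_0>0$, then for every $x>a_0/\gamma_0$ one has $T(x)<\infty$ almost surely (whatever the initial state: $\mathbb P\{T(x)<\infty\mid\varepsilon(0)=i\}=1$ for $i\in\{0,1\}$).
   Context: Let $\varepsilon=\varepsilon(t)\in\{0,1\}$, $t\ge0$, be a time-homogeneous two-state Markov process with positive switching intensities $\lambda_0,\lambda_1$: $\mathbb P\{\varepsilon(t+dt)=i\mid\varepsilon(t)=i\}=1-\lambda_i\,dt+o(dt)$, $dt\to 0$. Let $a_0,a_1\in\mathbb R$ and $\gamma_0,\gamma_1>0$ with $a_0/\gamma_0>a_1/\gamma_1$. The Ornstein-Uhlenbeck process of bounded variation $X=X(t)$ is the path-continuous solution of $$dX(t)=\bigl(a_{\varepsilon(t)}-\gamma_{\varepsilon(t)}X(t)\bigr)\,dt,\quad t>0,\qquad X(0)=x.$$ For $x>a_0/\gamma_0$ put $T(x)=\inf\{t:\ X(t)<a_0/\gamma_0\}$, where $X(0)=x$ (with $\inf\emptyset=+\infty$). *)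

(* Defs.v *)
From HB Require Import structures.
From mathcomp Require Import all_boot all_order all_algebra.
From mathcomp Require Import all_classical all_reals all_analysis.

Set Implicit Arguments.
Unset Strict Implicit.
Unset Printing Implicit Defensive.

Import Order.TTheory GRing.Theory Num.Theory.
Import numFieldNormedType.Exports.

Local Open Scope classical_set_scope.
Local Open Scope ring_scope.

(* The two states are encoded as booleans: false is state 0, true is state 1.
   Processes are indexed by R, and only times t >= 0 are ever constrained. *)

Definition condP (d : measure_display) (T : measurableType d) (R : realType)
    (P : probability T R) (A B : set T) : R :=
  fine (P (A `&` B)) / fine (P B).

Section two_state_process.
Context (d : measure_display) (T : measurableType d) (R : realType)
        (P : probability T R) (eps : R -> {RV P >-> bool}).

Definition at_state (t : R) (i : bool) : set T := [set w | eps t w = i].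

(* finitely many constraints "state (p.2) at time (p.1)" *)
Definition history (h : seq (R * bool)) : set T :=
  [set w | forall p, p \in h -> eps p.1 w = p.2].

(* Conditional probabilities are only constrained when the conditioning event
   has positive probability. *)
Definition markov_property : Prop :=
  forall (h : seq (R * bool)) (s t : R) (i j : bool),
    (forall p, p \in h -> 0 <= p.1 <= s) -> 0 <= s -> s <= t ->
    (0 < P (history h `&` at_state s i))%E ->
    condP P (at_state t j) (history h `&` at_state s i) =
    condP P (at_state t j) (at_state s i).

Definition time_homogeneous : Prop :=
  forall (s s' t : R) (i j : bool),
    0 <= s -> 0 <= s' -> 0 <= t ->
    (0 < P (at_state s i))%E -> (0 < P (at_state s' i))%E ->
    condP P (at_state (s + t) j) (at_state s i) =
    condP P (at_state (s' + t) j) (at_state s' i).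

(* P(eps (t+h) = i | eps t = i) = 1 - lam i * h + o(h) as h -> 0+ *)
Definition switching_intensities (lam : bool -> R) : Prop :=
  forall (t : R) (i : bool), 0 <= t -> (0 < P (at_state t i))%E ->
    (condP P (at_state (t + h) i) (at_state t i) - (1 - lam i * h)) / h
      @[h --> 0^'+] --> (0 : R).

(* bool carries the discrete topology: from every time t on, the state is
   constant on some interval [t, t + delta). *)
Definition right_continuous_paths : Prop :=
  forall (w : T) (t : R), 0 <= t -> eps s w @[s --> t^'+] --> eps t w.

(* Integral form of dX = (a_eps - gam_eps X) dt, X(0) = x, path by path. *)
Definition ou_solution (a gam : bool -> R) (x : R) (X : R -> {RV P >-> R}) :
    Prop :=
  forall w : T,
    [/\ X 0 w = x,
        {within `[0, +oo[, continuous (fun t => X t w)} &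
        forall t, 0 <= t ->
          X t w = x + \int[lebesgue_measure]_(s in `[0, t])
                        (a (eps s w) - gam (eps s w) * X s w)].

End two_state_process.

(* The infimum is taken in the extended reals, so it is +oo on the empty set. *)
Definition first_passage_below (R : realType) (T : Type) (X : R -> T -> R)
    (b : R) (w : T) : \bar R :=
  ereal_inf [set t%:E | t in [set t : R | 0 <= t /\ X t w < b]].

(* Main.v *)
Require Import Defs.
From HB Require Import structures.
From mathcomp Require Import all_boot all_order all_algebra.
From mathcomp Require Import all_classical all_reals all_analysis.
From mathcomp Require Import ring lra.

Import Order.TTheory GRing.Theory Num.Theory.
Import numFieldNormedType.Exports.

Local Open Scope classical_set_scope.
Local Open Scope ring_scope.

(** Write [rho = a false / gam false] for the equilibrium of state 0, and
    [c = gam true * rho - a true], which is positive because the equilibrium of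
    state 1 is below [rho]. As long as the path is above [rho] it does not
    increase, and in state 1 it decreases at speed at least [c]. So a path
    starting at [x] must cross [rho] as soon as the process spends an
    uninterrupted time [D > (x - rho) / c] in state 1
    ([crossing_of_long_stay]), and it remains to see that such a long stay
    almost surely happens.

    Cut time into blocks of equal length, each made of a short waiting time
    followed by a window of length at least [D]. Given the past, the process is
    in state 1 after the waiting time with a probability bounded below
    ([reach_true]) and then remains in state 1 through the window with a
    probability bounded below ([stay_true], [long_stay_true]). Hence each block
    contains a long stay with conditional probability at least some [q > 0], the
    first [n] blocks all fail with probability at most [(1 - q) ^ n]
    ([prob_all_fail]), and almost surely some block succeeds.

    The event of staying in state 1 on an interval constrains infinitely many
    times, while the Markov property only speaks of finitely many. Stays are
    therefore observed on dyadic grids with bounds uniform in the mesh; the mesh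
    is sent to 0 by monotone continuity of the probability, and right-continuity
    of the paths fills in the times off the grids
    ([right_continuous_true_on_dyadics]). *)

Set Implicit Arguments.
Unset Strict Implicit.
Unset Printing Implicit Defensive.

(** * Events of the past and the Markov property *)

Section probability_of_events.
Context (d : measure_display) (T : measurableType d) (R : realType)
        (P : probability T R).
Implicit Types A B : set T.

Lemma fine_prob_ge0 A : 0 <= fine (P A).
Proof. exact/fine_ge0/measure_ge0. Qed.

Lemma fine_prob_le {A B} : measurable A -> measurable B -> A `<=` B ->
  fine (P A) <= fine (P B).
Proof.
move=> mA mB AB; apply: fine_le; [exact: fin_num_measure..|].
by apply: le_measure; rewrite ?inE.
Qed.

Lemma fine_prob_eq0 {A B} : measurable A -> measurable B -> A `<=` B ->
  P B = 0%E -> fine (P A) = 0.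
Proof.
move=> mA mB AB B0; apply/eqP; rewrite eq_le fine_prob_ge0 andbT.
by apply: le_trans (fine_prob_le mA mB AB) _; rewrite B0.
Qed.

Lemma fine_prob_setIC {A B} : measurable A -> measurable B ->
  fine (P A) = fine (P (A `&` B)) + fine (P (A `&` ~` B)).
Proof.
move=> mA mB; rewrite -fineD; last 2 first.
- exact/fin_num_measure/measurableI.
- by apply/fin_num_measure/measurableI => //; exact: measurableC.
congr fine; rewrite -setDE addeC; exact: measureDI.
Qed.

End probability_of_events.

Section past_events.
Context (d : measure_display) (T : measurableType d) (R : realType)
        (P : probability T R) (eps : R -> {RV P >-> bool}).
Implicit Types (s t : R) (i j : bool) (E F : set T).

(** The events decided by finitely many observations of the path up to time
    [s]. Keeping an arbitrary Boolean test of the observed states makes the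
    class stable under complement, which plain histories are not. *)
Definition past s E : Prop := exists (ts : seq R) (phi : seq bool -> bool),
  (forall t, t \in ts -> 0 <= t <= s) /\
  E = [set w | phi [seq eps t w | t <- ts]].

Lemma measurable_at_state t i : measurable (at_state eps t i).
Proof.
exact: (measurable_funPTI (eps t) (Y := [set i])).
Qed.

Lemma at_stateC t i : ~` at_state eps t i = at_state eps t (~~ i).
Proof.
apply/seteqP; split=> w; rewrite /at_state /=; case: (eps t w); case: i => //.
Qed.

Lemma past_at s t i : 0 <= t <= s -> past s (at_state eps t i).
Proof.
move=> ts; exists [:: t], (fun b => head false b == i); split=> [u|].
  by rewrite inE => /eqP->.
by apply/seteqP; split=> w /=; rewrite /at_state /=; [move->|move/eqP].
Qed.

Lemma pastT s : past s setT.
Proof. by exists [::], xpredT; split=> //; apply/seteqP; split. Qed.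

Lemma past_le s t E : s <= t -> past s E -> past t E.
Proof.
move=> st [ts [phi [hts ->]]]; exists ts, phi; split=> // u /hts /andP[-> /=].
by move/le_trans; apply.
Qed.

Lemma pastC s E : past s E -> past s (~` E).
Proof.
move=> [ts [phi [hts ->]]]; exists ts, (predC phi); split=> //.
by apply/seteqP; split=> w /= /negP.
Qed.

Lemma pastI s E F : past s E -> past s F -> past s (E `&` F).
Proof.
move=> [ts [phi [hts ->]]] [us [psi [hus ->]]].
exists (ts ++ us),
  (fun b => phi (take (size ts) b) && psi (drop (size ts) b)); split.
  by move=> t; rewrite mem_cat => /orP[/hts|/hus].
apply/seteqP; split=> w /=; rewrite map_cat take_size_cat ?drop_size_cat ?size_map //.
  by case=> -> ->.
by move/andP.
Qed.

Lemma past_forall s n (E : nat -> set T) : (forall k, (k < n)%N -> past s (E k)) ->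
  past s [set w | forall k, (k < n)%N -> E k w].
Proof.
elim: n => [_|n IH h].
  by rewrite (_ : mkset _ = setT) //; [exact: pastT|apply/seteqP; split].
rewrite (_ : mkset _ = [set w | forall k, (k < n)%N -> E k w] `&` E n).
  by apply: pastI; [apply: IH => k kn; exact/h/ltnW|exact: h].
apply/seteqP; split=> w /=.
  by move=> H; split=> [k kn|]; apply: H => //; exact: ltnW.
by move=> [H En] k; rewrite ltnS leq_eqVlt => /orP[/eqP->//|/H].
Qed.

Lemma past_measurable s E : past s E -> measurable E.
Proof.
move=> [ts [phi [_ ->]]]; elim: ts phi => [|t ts IH] phi /=.
  by case: (phi [::]); [rewrite (_ : mkset _ = setT)|rewrite (_ : mkset _ = set0)] => //;
    apply/seteqP; split.
rewrite (_ : mkset _ =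
   (at_state eps t true `&` [set w | phi (true :: [seq eps t w | t <- ts])]) `|`
   (at_state eps t false `&` [set w | phi (false :: [seq eps t w | t <- ts])])).
  apply: measurableU; apply: measurableI; try exact: measurable_at_state.
  - exact: (IH (fun b => phi (true :: b))).
  - exact: (IH (fun b => phi (false :: b))).
apply/seteqP; split=> w /=; rewrite /at_state /=.
  by case: (eps t w); [left|right].
by case=> -[->].
Qed.

Lemma history_cons t i (h : seq (R * bool)) :
  history eps ((t, i) :: h) = history eps h `&` at_state eps t i.
Proof.
apply/seteqP; split=> w; rewrite /history /at_state /=.
  by move=> H; split=> [p ph|]; [apply: H; rewrite inE ph orbT|apply: (H (t, i)); rewrite inE eqxx].
by move=> [H e] p; rewrite inE => /orP[/eqP->|/H].
Qed.

Lemma measurable_history (h : seq (R * bool)) : measurable (history eps h).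
Proof.
elim: h => [|[t i] h IH].
  by rewrite (_ : history _ _ = setT) //; apply/seteqP; split.
by rewrite history_cons; apply: measurableI => //; exact: measurable_at_state.
Qed.

Context (hmarkov : markov_property eps).

(** The Markov property, given for atoms of the past (one prescribed state at
    each observation time), extends to every past event because such an event
    is a finite disjoint union of atoms. The induction turns the observations
    of [E] into entries of a history one at a time, splitting [E] according to
    the observed state. *)
Lemma markov_past s t i j E : past s E -> 0 <= s -> s <= t ->
  (0 < P (at_state eps s i))%E ->
  fine (P (E `&` at_state eps s i `&` at_state eps t j)) =
  condP P (at_state eps t j) (at_state eps s i) * fine (P (E `&` at_state eps s i)).
Proof.
move=> [ts [phi [hts ->]]] s0 st Pi.
set c := condP _ _ _.
suff H h : (forall p, p \in h -> 0 <= p.1 <= s) ->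
    let A := history eps h `&` [set w | phi [seq eps t w | t <- ts]] in
    fine (P (A `&` at_state eps s i `&` at_state eps t j)) =
    c * fine (P (A `&` at_state eps s i)).
  have /= := H [::] (fun p => ltac:(by [])).
  by rewrite (_ : history eps [::] = setT) ?setTI//; apply/seteqP; split.
elim: ts phi hts h => [|u ts IH] phi hts h hh A.
  rewrite {}/A /=; case: (phi [::]); last first.
    by rewrite (_ : mkset _ = set0) ?setI0 ?set0I ?measure0 ?mulr0//;
      apply/seteqP; split.
  rewrite (_ : mkset _ = setT) ?setIT; last by apply/seteqP; split.
  set B := history eps h `&` at_state eps s i.
  have mB : measurable B.
    by apply: measurableI; [exact: measurable_history|exact: measurable_at_state].
  have [B0|] := eqVneq (P B) 0%E.
    rewrite B0 mulr0; apply: (fine_prob_eq0 _ mB) => //.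
    by apply: measurableI => //; exact: measurable_at_state.
  rewrite neq_lt ltNge measure_ge0 /= => PB.
  rewrite /c -(@hmarkov h s t i j hh s0 st PB) /condP -/B setIC divfK//.
  apply/eqP => B0; move: PB; rewrite -[P B]fineK ?B0 ?ltxx//.
  exact: fin_num_measure.
pose B b := history eps ((u, b) :: h) `&`
  [set w | phi (b :: [seq eps t w | t <- ts])].
have -> : A = B true `|` B false.
  rewrite /B !history_cons; apply/seteqP; split=> w; rewrite /A /at_state /=.
    by case: (eps u w) => -[]; [left|right].
  by case=> -[[hw ->]].
have hts' t' : t' \in ts -> 0 <= t' <= s by move=> h'; apply: hts; rewrite inE h' orbT.
have hh' b p : p \in (u, b) :: h -> 0 <= p.1 <= s.
  by rewrite inE => /orP[/eqP->|/hh//]; apply: hts; rewrite mem_head.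
have eB b : fine (P (B b `&` (at_state eps s i `&` at_state eps t j))) =
    c * fine (P (B b `&` at_state eps s i)).
  by rewrite setIA; exact: (IH (fun l => phi (b :: l)) hts' _ (hh' b)).
have mB b : measurable (B b).
  apply: measurableI; first exact: measurable_history.
  by apply: (@past_measurable s); exists ts, (fun l => phi (b :: l)).
have dis : B true `&` B false = set0.
  apply/seteqP; split=> w //; rewrite /B !history_cons /at_state /=.
  by move=> -[[[_ ->]] _ [[_]]].
have ad C : measurable C -> fine (P (B true `&` C `|` B false `&` C)) =
      fine (P (B true `&` C)) + fine (P (B false `&` C)).
  move=> mC; rewrite -fineD; [|exact/fin_num_measure/measurableI..].
  rewrite measureU//; [exact: measurableI..|].
  apply/seteqP; split=> w //= -[[a1 _] [a2 _]].
  suff: (B true `&` B false) w by rewrite dis.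
  by split.
have mA r b : measurable (at_state eps r b) by exact: measurable_at_state.
rewrite -!setIA !setIUl !ad//; last exact: measurableI.
by rewrite !eB mulrDr.
Qed.

End past_events.

(** * Lower bounds for the probability of a long stay in state 1 *)

Section transition_bounds.
Context (d : measure_display) (T : measurableType d) (R : realType)
        (P : probability T R) (eps : R -> {RV P >-> bool}) (lam : bool -> R)
        (hmarkov : markov_property eps) (hhom : time_homogeneous eps)
        (hint : switching_intensities eps lam).
Implicit Types (s h : R) (i : bool) (E : set T).

(** The infinitesimal rates, made uniform: the intensity hypothesis gives a
    threshold [delta] that may depend on the time, and time-homogeneity
    transports the threshold of one charged time to all the others. The factors
    2 and 1/2 absorb the error term [o(h)]. For a state of
    probability zero both bounds read [0 <= 0 <= 0]. *)
Lemma intensity_bounds i : 0 < lam i ->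
  exists2 delta, 0 < delta & forall h s E, 0 < h -> h < delta -> 0 <= s ->
    past eps s E ->
    (1 - 2 * lam i * h) * fine (P (E `&` at_state eps s i)) <=
      fine (P (E `&` at_state eps s i `&` at_state eps (s + h) i)) <=
    (1 - lam i / 2 * h) * fine (P (E `&` at_state eps s i)).
Proof.
move=> li.
have mA t : measurable (at_state eps t i) by exact: measurable_at_state.
have null h s E : measurable E -> P (at_state eps s i) = 0%E ->
    (1 - 2 * lam i * h) * fine (P (E `&` at_state eps s i)) <=
      fine (P (E `&` at_state eps s i `&` at_state eps (s + h) i)) <=
    (1 - lam i / 2 * h) * fine (P (E `&` at_state eps s i)).
  move=> mE Ps; have mEA := measurableI _ _ mE (mA s).
  rewrite (@fine_prob_eq0 _ _ _ P (E `&` _) _ mEA (mA s) _ Ps); last by move=> w [].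
  rewrite (@fine_prob_eq0 _ _ _ P _ _ (measurableI _ _ mEA (mA (s + h))) (mA s) _ Ps).
    by rewrite !mulr0 lexx.
  by move=> w [[]].
case: (pselect (exists2 s0, 0 <= s0 & (0 < P (at_state eps s0 i))%E)); last first.
  move=> N; exists 1 => // h s E h0 _ s_ge0 pE.
  apply: null; first exact: past_measurable pE.
  apply/eqP; rewrite eq_le measure_ge0 andbT leNgt.
  by apply/negP => Ps; apply: N; exists s.
move=> [s0 s00 P0].
have l2 : 0 < lam i / 2 by rewrite divr_gt0.
have /cvgrPdist_lt/(_ _ l2) := @hint s0 i s00 P0.
rewrite near_withinE => /nbhs_ballP[delta /= d0 hd].
exists delta => // h s E h0 hdl s_ge0 pE.
have [Ps|] := eqVneq (P (at_state eps s i)) 0%E.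
  by apply: null Ps; exact: past_measurable pE.
rewrite neq_lt ltNge measure_ge0 /= => Ps.
have sh : s <= s + h by rewrite lerDl ltW.
rewrite (markov_past hmarkov i pE s_ge0 sh Ps).
(* the rate near s0 is the rate near s, with the same threshold delta *)
rewrite (@hhom s s0 h i i s_ge0 s00 (ltW h0) Ps P0).
have := hd h; rewrite /ball /= sub0r normrN gtr0_norm// => /(_ hdl h0).
rewrite sub0r normrN ltr_norml; move: (condP _ _ _) => c /andP[c1 c2].
move: c1 c2; rewrite ltr_pdivrMr// ltr_pdivlMr// => c1 c2.
have p0 := fine_prob_ge0 P (E `&` at_state eps s i).
by apply/andP; split; apply: ler_wpM2r => //; nra.
Qed.

Context (hlam0 : 0 < lam false) (hlam1 : 0 < lam true).

(** Whatever the current state, state 1 is occupied a short time later with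
    a chance bounded below: from state 1 by staying, from state 0 because the
    chance of staying there is at most [1 - lam false / 2 * h], which is where
    the positivity of [lam false] enters. *)
Lemma reach_true : exists h k : R, [/\ 0 < h, 0 < k &
  forall s E, 0 <= s -> past eps s E ->
    k * fine (P E) <= fine (P (E `&` at_state eps (s + h) true))].
Proof.
have [d1 d10 H1] := intensity_bounds hlam1.
have [d0 d00 H0] := intensity_bounds hlam0.
(* below both thresholds, and small enough for [1 - 2 * lam true * h > 0] *)
pose h := Num.min (Num.min d1 d0) (lam true)^-1 / 4.
have mn0 : 0 < Num.min (Num.min d1 d0) (lam true)^-1 by rewrite !lt_min d10 d00 invr_gt0.
have h0 : 0 < h by rewrite divr_gt0.
have hm : h < Num.min (Num.min d1 d0) (lam true)^-1.
  by rewrite /h; lra.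
have h4 : 4 * h <= (lam true)^-1.
  have -> : 4 * h = Num.min (Num.min d1 d0) (lam true)^-1 by rewrite /h; lra.
  by rewrite ge_min lexx orbT.
have h5 : 4 * lam true * h <= 1.
  by rewrite mulrAC -ler_pdivlMr// div1r.
move: hm; rewrite !lt_min => /andP[/andP[hd1 hd0] _].
exists h, (Num.min (1 - 2 * lam true * h) (lam false / 2 * h)); split=> //.
  by rewrite lt_min; apply/andP; split; [nra|rewrite !mulr_gt0].
move=> s E s0 pE.
have mE := past_measurable pE.
have mA t i : measurable (at_state eps t i) by exact: measurable_at_state.
set k := Num.min _ _.
have k1 : k <= 1 - 2 * lam true * h by rewrite ge_min lexx.
have k2 : k <= lam false / 2 * h by rewrite ge_min lexx orbT.
have /andP[a1 _] := H1 h s E h0 hd1 s0 pE.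
have /andP[_ a2] := H0 h s E h0 hd0 s0 pE.
have e1 := @fine_prob_setIC _ _ _ P _ _ mE (mA s true).
have e2 := @fine_prob_setIC _ _ _ P _ _ (measurableI _ _ mE (mA (s + h) true)) (mA s true).
have e3 := @fine_prob_setIC _ _ _ P _ _ (measurableI _ _ mE (mA s false)) (mA (s + h) true).
rewrite !at_stateC /= in e1 e2 e3.
move: e2; rewrite !(setIAC _ (at_state eps (s + h) true)) => e2.
have p1 := fine_prob_ge0 P (E `&` at_state eps s true).
have p0 := fine_prob_ge0 P (E `&` at_state eps s false).
rewrite e1 e2 mulrDr; apply: lerD; first by apply: le_trans a1; exact: ler_wpM2r.
have q := ler_wpM2r p0 k2.
apply: le_trans q _.
by move: e3 a2; lra.
Qed.

(** A finite stand-in for the event that the path stays in state 1 on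
    [[t, t + n * eta]]; unlike the latter it is a past event. *)
Definition true_on_grid t (eta : R) n : set T :=
  [set w | forall k, (k <= n)%N -> eps (t + k%:R * eta) w = true].

Lemma past_true_on_grid t eta n u : 0 <= t -> 0 <= eta -> t + n%:R * eta <= u ->
  past eps u (true_on_grid t eta n).
Proof.
move=> t0 eta0 tu.
apply: (@past_forall _ _ _ _ _ _ n.+1
   (fun k => at_state eps (t + k%:R * eta) true)) => k kn.
apply: past_at; rewrite addr_ge0 ?mulr_ge0//=.
by apply: le_trans tu; rewrite lerD2l ler_wpM2r// ler_nat.
Qed.

Lemma measurable_true_on_grid t eta n : measurable (true_on_grid t eta n).
Proof.
rewrite (_ : true_on_grid _ _ _ =
   \bigcap_(k in [set k | (k <= n)%N]) at_state eps (t + k%:R * eta) true) //.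
by apply: bigcap_measurableType => k _; exact: measurable_at_state.
Qed.

Lemma stay_true : exists2 delta, 0 < delta & forall (eta t : R) n E,
  0 < eta -> eta < delta -> 2 * lam true * eta <= 1 -> 0 <= t -> past eps t E ->
  (1 - 2 * lam true * eta) ^+ n * fine (P (E `&` at_state eps t true)) <=
    fine (P (E `&` true_on_grid t eta n)).
Proof.
have [delta d0 H] := intensity_bounds hlam1; exists delta => // eta t n E eta0 etad le1 t0 pE.
elim: n => [|n IH].
  rewrite expr0 mul1r (_ : true_on_grid t eta 0 = at_state eps t true)//.
  apply/seteqP; split=> w; rewrite /true_on_grid /at_state /=.
    by move=> /(_ 0%N (leqnn _)); rewrite mul0r addr0.
  by move=> e k; rewrite leqn0 => /eqP->; rewrite mul0r addr0.
rewrite exprS -mulrA; apply: (le_trans (ler_wpM2l _ IH)); first by rewrite subr_ge0.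
have u0 : 0 <= t + n%:R * eta by rewrite addr_ge0 // mulr_ge0 // ltW.
have tu : t <= t + n%:R * eta by rewrite lerDl mulr_ge0// ltW.
have pF : past eps (t + n%:R * eta) (E `&` true_on_grid t eta n).
  apply: pastI; first exact: past_le pE.
  by apply: past_true_on_grid => //; exact: ltW.
have /andP[+ _] := H eta _ _ eta0 etad u0 pF.
rewrite -setIA (_ : true_on_grid t eta n `&` at_state _ _ _ = true_on_grid t eta n); last first.
  by apply/seteqP; split=> w; [case|move=> H'; split=> //; exact: H'].
move/le_trans; apply; apply: fine_prob_le.
- apply: measurableI; last exact: measurable_at_state.
  apply: measurableI; first exact: past_measurable pE.
  exact: measurable_true_on_grid.
- apply: measurableI; first exact: past_measurable pE.
  exact: measurable_true_on_grid.
move=> w [[Ew Gw] e]; split=> // k; rewrite leq_eqVlt => /orP[/eqP->|kn].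
  by rewrite -[in RHS]e; congr (eps _ w); rewrite -natr1 mulrDl mul1r addrA.
exact: Gw.
Qed.

Lemma bernoulli_one_sub (y : R) n : 0 <= y <= 1 -> 1 - n%:R * y <= (1 - y) ^+ n.
Proof.
move=> /andP[y0 y1]; elim: n => [|n IH]; first by rewrite mul0r subr0 expr0.
rewrite exprS -natr1; have n0 : 0 <= n%:R :> R by [].
have := ler_wpM2l _ IH (x := 1 - y); rewrite subr_ge0 => /(_ y1); nra.
Qed.

(** The lower bound [q] must not depend on the fineness [m] of the grid. Take
    [theta] at most [1 / (4 * lam true)]: by Bernoulli's inequality, surviving
    one stretch of length [theta] cut into [2 ^ m] steps costs a factor at least
    1/2, uniformly in [m], and [M] such stretches cover the length [D]. *)
Lemma long_stay_true (D : R) : exists (h theta q : R) (M : nat),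
  [/\ 0 < h, 0 < theta, 0 < q <= 1, D <= M%:R * theta &
  forall m s E, 0 <= s -> past eps s E ->
    q * fine (P E) <=
    fine (P (E `&` true_on_grid (s + h) (theta / 2 ^+ m) (M * 2 ^ m)))].
Proof.
have [h [k [h0 k0 Hr]]] := reach_true.
have [delta d0 Hs] := stay_true.
pose theta := Num.min delta (lam true)^-1 / 4.
have mn0 : 0 < Num.min delta (lam true)^-1 by rewrite !lt_min d0 invr_gt0.
have th0 : 0 < theta by rewrite divr_gt0.
have thd : theta < delta.
  have : Num.min delta (lam true)^-1 <= delta by rewrite ge_min lexx.
  by rewrite /theta; lra.
have th4 : 4 * lam true * theta <= 1.
  rewrite mulrAC -ler_pdivlMr// div1r.
  have -> : 4 * theta = Num.min delta (lam true)^-1 by rewrite /theta; lra.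
  by rewrite ge_min lexx orbT.
pose M := (Num.truncn (`|D| / theta)).+1.
exists h, theta, (Num.min 1 ((2^-1) ^+ M * k)), M; split=> //.
- by rewrite lt_min ltr01 /= mulr_gt0 ?exprn_gt0// ge_min lexx.
- apply: le_trans (ler_norm D) _; rewrite -ler_pdivrMr// /M.
  exact/ltW/truncnS_gt.
move=> m s E s0 pE; set eta := theta / 2 ^+ m.
have tm1 : 1 <= 2 ^+ m :> R by rewrite exprn_ege1// ler1n.
have tm0 : 0 < 2 ^+ m :> R by apply: lt_le_trans tm1.
have eta0 : 0 < eta by rewrite divr_gt0.
have etath : eta <= theta by rewrite ler_pdivrMr// ler_peMr// ltW.
have sh0 : 0 <= s + h by rewrite addr_ge0// ltW.
have y0 : 0 <= 2 * lam true * eta by rewrite !mulr_ge0// ltW.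
have y1 : 2 * lam true * eta <= 1.
  by apply: le_trans th4; apply: ler_pM => //; [nra|exact: ltW|nra].
have pE' : past eps (s + h) E by apply: past_le pE; rewrite lerDl ltW.
apply: le_trans (Hs eta (s + h) (M * 2 ^ m)%N E eta0 (le_lt_trans etath thd) y1 sh0 pE').
have b : (2^-1) ^+ M <= (1 - 2 * lam true * eta) ^+ (M * 2 ^ m).
  rewrite mulnC exprM; apply: lerXn2r; rewrite ?nnegrE ?exprn_ge0 ?subr_ge0//.
  apply: le_trans (bernoulli_one_sub (2 ^ m) _); last by rewrite y0 y1.
  rewrite natrX /eta.
  have -> : 2 ^+ m * (2 * lam true * (theta / 2 ^+ m)) = 2 * lam true * theta.
    by field; rewrite gt_eqF.
  by move: th4; lra.
apply: le_trans (ler_wpM2r (fine_prob_ge0 P _) b).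
have r := Hr s E s0 pE.
apply: le_trans (_ : ((2^-1) ^+ M * k) * fine (P E) <= _).
  by apply: ler_wpM2r; [exact: fine_prob_ge0|rewrite ge_min lexx orbT].
by rewrite -mulrA ler_wpM2l// exprn_ge0.
Qed.

End transition_bounds.

(** * Repeated trials *)

(** Right-continuity into a discrete space makes [g] constant just after each
    time [t], and some dyadic grid point falls there. *)
Lemma right_continuous_true_on_dyadics (R : realType) (g : R -> bool)
    (t0 theta : R) (M : nat) :
  (forall t, 0 <= t -> g s @[s --> t^'+] --> g t) ->
  0 <= t0 -> 0 < theta ->
  (forall m k, (k <= M * 2 ^ m)%N -> g (t0 + k%:R * (theta / 2 ^+ m)) = true) ->
  forall t, t0 <= t -> t < t0 + M%:R * theta -> g t = true.
Proof.
move=> rc t00 th0 H t t0t tM.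
have t_ge0 : 0 <= t by apply: le_trans t0t.
have : \forall s \near t^'+, g s = g t.
  apply: (rc t t_ge0 [set b | b = g t]).
  by rewrite nbhs_principalE; apply/principal_filterP.
rewrite near_withinE => /nbhs_ballP[e /= e0 he].
(* mesh smaller than [e]; then [k + 1] is the first grid index after [t] *)
pose m := (Num.truncn (theta / e)).+1; set eta := theta / 2 ^+ m.
have tm0 : 0 < 2 ^+ m :> R by rewrite exprn_gt0.
have eta0 : 0 < eta by rewrite divr_gt0.
have etae : eta < e.
  rewrite /eta ltr_pdivrMr// mulrC -ltr_pdivrMr//.
  apply: lt_trans (truncnS_gt _) _; rewrite -/m -natrX ltr_nat.
  exact: ltn_expl.
have y0 : 0 <= (t - t0) / eta by rewrite divr_ge0 ?subr_ge0// ltW.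
have /andP[k1 k2] := truncn_itv y0.
set k := Num.truncn _ in k1 k2.
rewrite ler_pdivlMr// in k1; rewrite ltr_pdivrMr// in k2.
have kM : (k.+1 <= M * 2 ^ m)%N.
  rewrite -(ltr_nat R) natrM natrX -(ltr_pM2r eta0); apply: le_lt_trans k1 _.
  have -> : M%:R * 2 ^+ m * eta = M%:R * theta by rewrite /eta; field; rewrite gt_eqF.
  by lra.
have := H m k.+1 kM; rewrite -/eta => <-; symmetry; apply: he.
  rewrite /ball /= -natr1 ltr_norml; apply/andP; split.
    by move: k1 etae e0; rewrite mulrDl mul1r; lra.
  by move: k2 etae e0; rewrite -natr1 mulrDl mul1r; lra.
by move: k2; lra.
Qed.

Section repeated_trials.
Context (d : measure_display) (T : measurableType d) (R : realType)
        (P : probability T R) (eps : R -> {RV P >-> bool})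
        (h theta q : R) (M : nat).
Context (h0 : 0 < h) (th0 : 0 < theta) (q01 : 0 < q <= 1)
  (trial : forall m s E, 0 <= s -> past eps s E ->
    q * fine (P E) <=
    fine (P (E `&` true_on_grid eps (s + h) (theta / 2 ^+ m) (M * 2 ^ m)))).

Let L := h + M%:R * theta.

Let L_ge0 : 0 <= L.
Proof. by rewrite addr_ge0 ?mulr_ge0// ltW. Qed.

Definition success m j : set T :=
  true_on_grid eps (j%:R * L + h) (theta / 2 ^+ m) (M * 2 ^ m).

Definition all_fail n m : set T :=
  [set w | forall j, (j < n)%N -> (~` success m j) w].

Lemma past_success m j : past eps (j.+1%:R * L) (success m j).
Proof.
apply: past_true_on_grid.
- by rewrite addr_ge0 ?mulr_ge0// ltW.
- by rewrite divr_ge0 ?exprn_ge0// ltW.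
rewrite natrM natrX -[j.+1%:R]natr1 mulrDl mul1r -addrA lerD2l /L lerD2l.
have -> // : M%:R * 2 ^+ m * (theta / 2 ^+ m) = M%:R * theta.
by field; rewrite gt_eqF// exprn_gt0.
Qed.

Lemma past_all_fail n m : past eps (n%:R * L) (all_fail n m).
Proof.
apply: past_forall => j jn; apply: pastC; apply: past_le (past_success m j).
by rewrite ler_wpM2r// ler_nat.
Qed.

(** Each trial fails with conditional probability at most [1 - q] given the
    outcome of the preceding ones, since that outcome is a past event when the
    trial starts. *)
Lemma prob_all_fail n m : fine (P (all_fail n m)) <= (1 - q) ^+ n.
Proof.
have /andP[q0 q1] := q01.
elim: n => [|n IH].
  rewrite expr0 (_ : all_fail 0 m = setT) ?probability_setT//.
  by apply/seteqP; split.
have pF := past_all_fail n m.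
have mF := past_measurable pF.
have mS := past_measurable (past_success m n).
have -> : all_fail n.+1 m = all_fail n m `&` ~` success m n.
  apply/seteqP; split=> w.
    by move=> H; split=> [j jn|]; apply: H => //; exact: ltnW.
  by move=> [H Hn] j; rewrite ltnS leq_eqVlt => /orP[/eqP->//|/H].
have := @fine_prob_setIC _ _ _ P _ _ mF mS.
have /(_ m) := trial _ _ pF; rewrite mulr_ge0// => /(_ isT).
rewrite exprS; have := fine_prob_ge0 P (all_fail n m).
move: IH; rewrite -/(success m n).
set x := fine (P (all_fail n m)); set y := (1 - q) ^+ n => IH x0 a b.
by nra.
Qed.

(** The grid of fineness [m] is contained in the grid of fineness [m + 1]. *)
Lemma success_succ m j : success m.+1 j `<=` success m j.
Proof.
move=> w H k kM.
have := H (k * 2)%N; rewrite expnSr mulnA leq_mul2r kM orbT => /(_ isT) <-.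
congr (eps (_ + _) w); rewrite natrM exprSr.
by field; rewrite gt_eqF// exprn_gt0.
Qed.

Lemma success_le m m' j : (m <= m')%N -> success m' j `<=` success m j.
Proof.
elim: m' => [|m' IH]; first by rewrite leqn0 => /eqP->.
rewrite leq_eqVlt => /orP[/eqP->//|/IH H].
exact/(subset_trans _ H)/success_succ.
Qed.

Lemma all_fail_ndecr n : {homo all_fail n : m m' / (m <= m')%N >-> (m <= m')%O}.
Proof.
move=> m m' mm'; apply/subsetPset => w H j jn S; apply: (H j jn).
exact: success_le S.
Qed.

(** The event that none of the first [n] trials succeeds on all dyadic grids:
    refining the grid only destroys successes, hence these unions are monotone
    limits and keep the bound of the finite grids. *)
Definition eventually_all_fail n : set T := \bigcup_m all_fail n m.

Lemma measurable_eventually_all_fail n : measurable (eventually_all_fail n).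
Proof. by apply: bigcupT_measurable => m; exact: past_measurable (past_all_fail n m). Qed.

Lemma prob_eventually_all_fail n : fine (P (eventually_all_fail n)) <= (1 - q) ^+ n.
Proof.
rewrite -lee_fin fineK; last first.
  exact/fin_num_measure/measurable_eventually_all_fail.
have c : P \o all_fail n @ \oo --> P (eventually_all_fail n).
  apply: nondecreasing_cvg_mu; last exact: all_fail_ndecr.
    by move=> m; exact: past_measurable (past_all_fail n m).
  exact: measurable_eventually_all_fail.
apply: (cvge_le _ c); near=> m.
rewrite /= -[leLHS]fineK ?lee_fin; first exact: prob_all_fail.
exact/fin_num_measure/past_measurable/past_all_fail.
Unshelve. all: by end_near. Qed.

Lemma prob_never_success : P (\bigcap_n eventually_all_fail n) = 0%E.
Proof.
have /andP[q0 q1] := q01.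
have mF : measurable (\bigcap_n eventually_all_fail n).
  by apply: bigcapT_measurable => n; exact: measurable_eventually_all_fail.
rewrite -[LHS]fineK; last exact: fin_num_measure.
congr EFin; apply/eqP; rewrite eq_le fine_prob_ge0 andbT.
have c : (1 - q) ^+ n @[n --> \oo] --> (0 : R).
  by apply: cvg_expr; rewrite ger0_norm ?subr_ge0// gtrBl.
apply: (ler_cvg_to (cvg_cst _) c); near=> n.
apply: le_trans (prob_eventually_all_fail n); apply: fine_prob_le => //.
  exact: measurable_eventually_all_fail.
by move=> w; apply.
Unshelve. all: by end_near. Qed.

(** If every trial failed on some grid, then the finest of the grids for the
    first [n] trials would witness failure of all of them at once. *)
Lemma success_of_not_never w : ~ (\bigcap_n eventually_all_fail n) w ->
  exists j, forall m, success m j w.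
Proof.
apply: contra_notP => /forallNP N n _.
suff [m Hm] : exists m, forall j, (j < n)%N -> ~ success m j w by exists m.
elim: n => [|n [m Hm]]; first by exists 0%N.
have /existsNP[m' Hm'] := N n.
exists (maxn m m') => j; rewrite ltnS leq_eqVlt => /orP[/eqP->|jn] S.
  by apply: Hm'; apply: success_le S; exact: leq_maxr.
by apply: (Hm j jn); apply: success_le S; exact: leq_maxl.
Qed.

End repeated_trials.

(** The trials cannot all fail, and a trial that succeeds on every dyadic grid
    is a genuine stay in state 1, by right-continuity. *)
Lemma ae_long_stay_true (d : measure_display) (T : measurableType d) (R : realType)
    (P : probability T R) (eps : R -> {RV P >-> bool}) (lam : bool -> R) (D : R) :
  markov_property eps -> time_homogeneous eps -> right_continuous_paths eps ->
  switching_intensities eps lam -> 0 < lam false -> 0 < lam true ->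
  {ae P, forall w, exists2 t0, 0 <= t0 &
    forall t, t0 <= t -> t < t0 + D -> eps t w = true}.
Proof.
move=> hm hh hr hi l0 l1.
have [h [theta [q [M [h0 th0 q01 DM trial]]]]] := long_stay_true hm hh hi l0 l1 D.
exists (\bigcap_n eventually_all_fail eps h theta M n); split.
- by apply: bigcapT_measurable => n; exact: measurable_eventually_all_fail.
- exact: (prob_never_success h0 th0 q01 trial).
move=> w /= N; apply: contrapT => /success_of_not_never [j S]; apply: N.
set t0 := j%:R * (h + M%:R * theta) + h.
have t00 : 0 <= t0.
  by rewrite addr_ge0 ?mulr_ge0 ?addr_ge0 ?mulr_ge0 // ltW.
exists t0 => // t t0t tD.
apply: (@right_continuous_true_on_dyadics R (eps ^~ w) t0 theta M) => //.
- by move=> s s0; exact: hr.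
- by apply: (lt_le_trans tD); rewrite lerD2l.
Qed.

(** * Paths: a long stay in state 1 forces a crossing *)

(** The integral of a nonnegative function is the supremum of the integrals of
    the simple functions below it, hence is monotone without any measurability.
    It is applied to the drift along a fixed path. *)
Lemma ge0_le_integral_nonmeasurable (d : measure_display) (T : measurableType d)
    (R : realType) (mu : {measure set T -> \bar R}) (A : set T)
    (f g : T -> \bar R) :
  (forall x, A x -> (0 <= f x)%E) -> (forall x, A x -> (f x <= g x)%E) ->
  (\int[mu]_(x in A) f x <= \int[mu]_(x in A) g x)%E.
Proof.
move=> f0 fg; have g0 x : A x -> (0 <= g x)%E.
  by move=> Ax; exact: le_trans (f0 _ Ax) (fg _ Ax).
rewrite !ge0_integralE//; apply: le_ereal_sup => _ [h hf <-].
exists h => //= x; apply: le_trans (hf x) _; rewrite /patch.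
by case: ifP => // /set_mem; exact: fg.
Qed.

Section deterministic_path.
Context (R : realType) (a gam : bool -> R) (x : R) (e : R -> bool) (Y : R -> R).

(** Suppose that the path never goes below [rho], the equilibrium of state 0.
    The drift is then nonpositive in state 0 and at most [- c] in state 1, with
    [c = gam true * rho - a true > 0]. Hence the path stays between [rho] and
    [x], and during the stay in state 1 it loses [c * D], which is more than
    [x - rho]: a contradiction. *)
Lemma crossing_of_long_stay (t0 D : R) :
  0 < gam false -> 0 < gam true -> a true / gam true < a false / gam false ->
  (forall t, 0 <= t ->
     Y t = x + \int[lebesgue_measure]_(s in `[0, t]) (a (e s) - gam (e s) * Y s)) ->
  0 <= t0 -> 0 < D -> (forall t, t0 <= t -> t < t0 + D -> e t = true) ->
  x - a false / gam false < (gam true * (a false / gam false) - a true) * D ->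
  exists t, 0 <= t /\ Y t < a false / gam false.
Proof.
move=> g0 g1 ag HY t00 D0 He HD; apply: contrapT => /forallNP N.
set rho := a false / gam false in ag HD N *.
have Yge t : 0 <= t -> rho <= Y t.
  by move=> t_ge0; rewrite leNgt; apply/negP => Yt; apply: (N t).
have a0 : a false = gam false * rho by rewrite /rho mulrC divfK// gt_eqF.
set c := gam true * rho - a true in HD.
have c0 : 0 < c by rewrite /c subr_gt0 mulrC -ltr_pdivrMr.
(* minus the drift: the nonnegative speed of descent *)
pose g s := gam (e s) * Y s - a (e s).
have gge0 s : 0 <= s -> 0 <= g s.
  move=> /Yge Ys; rewrite /g; case: (e s); last by rewrite a0 -mulrBr mulr_ge0 ?subr_ge0// ltW.
  have := ler_wpM2l (ltW g1) Ys; move: c0; rewrite /c; lra.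
have gc s : 0 <= s -> e s = true -> c <= g s.
  by move=> /Yge Ys es; rewrite /g es /c lerD2r ler_wpM2l// ltW.
pose I t := (\int[lebesgue_measure]_(s in `[0%R, t]) (g s)%:E)%E.
have HI t : 0 <= t -> Y t = x - fine (I t).
  move=> t_ge0; rewrite (HY t t_ge0); congr (_ + _).
  rewrite /Rintegral /I -fineN -integral_ge0N; last first.
    by move=> s /=; rewrite in_itv/= => /andP[s0 _]; rewrite lee_fin gge0.
  congr fine; apply: eq_integral => s _; rewrite -EFinN; congr EFin.
  by rewrite /g opprB.
have I0 t : (0 <= I t)%E.
  apply: integral_ge0 => s /=; rewrite in_itv/= => /andP[s0 _].
  by rewrite lee_fin gge0.
have Yle t : 0 <= t -> Y t <= x.
  by move=> /HI ->; rewrite gerBl fine_ge0.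
pose K := `|gam false * x - a false| + `|gam true * x - a true|.
have gK s : 0 <= s -> g s <= K.
  move=> /Yle Ys.
  apply: le_trans (_ : gam (e s) * x - a (e s) <= K).
    by rewrite /g lerD2r ler_wpM2l//; case: (e s); exact: ltW.
  rewrite /K; case: (e s); apply: le_trans (ler_norm _) _.
    by rewrite lerDr.
  by rewrite lerDl.
set t1 := t0 + D.
have t1_ge0 : 0 <= t1 by rewrite addr_ge0// ltW.
(* [fine] would send an infinite integral to 0, so that finiteness matters *)
have Ifin : I t1 \is a fin_num.
  rewrite ge0_fin_numE//; apply: (@le_lt_trans _ _ (\int[lebesgue_measure]_(s in `[0%R, t1]) (cst K%:E s))%E).
    apply: ge0_le_integral_nonmeasurable => s /=; rewrite in_itv/= => /andP[s0 _];
      by rewrite lee_fin ?gge0 ?gK.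
  rewrite integral_cst//= lebesgue_measure_itv/=; case: ifP => _; last by rewrite mule0 ltry.
  by rewrite -EFinB -EFinM ltry.
have cDI : c * D <= fine (I t1).
  rewrite -lee_fin fineK//.
  apply: (@le_trans _ _ (\int[lebesgue_measure]_(s in `[0%R, t1])
      ((cst c%:E) \_ `[t0, t1[) s)%E); last first.
    apply: ge0_le_integral_nonmeasurable => s /=; rewrite in_itv/= => /andP[s0 _].
      by apply: erestrict_ge0 => r _; rewrite lee_fin ltW.
    rewrite /patch; case: ifPn => [|_]; last by rewrite lee_fin gge0.
    by rewrite inE/= in_itv/= => /andP[s1 s2]; rewrite lee_fin gc// He.
  rewrite -integral_mkcondr (_ : _ `&` _ = `[t0, t1[%classic); last first.
    apply/seteqP; split=> s /=; rewrite !in_itv/=; first by case.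
    move=> /andP[s1 s2]; split; last by rewrite s1.
    by rewrite (le_trans t00 s1) ltW.
  rewrite integral_cst//=.
  by rewrite lebesgue_measure_itv/= lte_fin ltrDl D0 -EFinB -EFinM lee_fin /t1 addrAC subrr add0r.
have := Yge t1 t1_ge0; rewrite HI//; move: cDI HD; lra.
Qed.

(** Thanks to continuity the event of finite passage is a union over rational
    times, hence measurable. *)
Lemma crossing_at_rational (b t : R) :
  {within `[0, +oo[, continuous Y} -> 0 <= t -> Y t < b ->
  exists2 r : rat, 0 <= r & Y (ratr r) < b.
Proof.
move=> /continuous_within_itvcyP[cY cY0] t_ge0 Yb.
have /cvgrPdist_lt/(_ (b - Y t)) : Y s @[s --> t^'+] --> Y t.
  move: t_ge0; rewrite le_eqVlt => /orP[/eqP<-//|t0].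
  by apply/cvg_at_right_filter/cY; rewrite in_itv/= t0.
rewrite subr_gt0 => /(_ Yb); rewrite near_withinE => /nbhs_ballP[r /= r0 H].
have [|p] := @rat_in_itvoo R t (t + r); first by rewrite ltrDl.
rewrite in_itv/= => /andP[p1 p2]; exists p.
  by rewrite -(@ler0q R) (le_trans t_ge0)// ltW.
have pb : ball t r (ratr p).
  by rewrite /ball/= ltr_norml; apply/andP; split; lra.
by have := H _ pb p1; rewrite ltr_norml => /andP[+ _]; lra.
Qed.

End deterministic_path.

(** * The passage time is almost surely finite *)

Lemma first_passage_lty (R : realType) (T : Type) (X : R -> T -> R) (b : R) (w : T) :
  (first_passage_below X b w < +oo)%E <-> exists t, 0 <= t /\ X t w < b.
Proof.
split.
  by move/ereal_inf_ltP => [_ [t [t0 Xt] <-] _]; exists t.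
by move=> [t tX]; apply/ereal_inf_ltP; exists t%:E; [exists t|exact: ltry].
Qed.

Unset Implicit Arguments.
Set Strict Implicit.
Set Printing Implicit Defensive.

Theorem theorem3p1 (R : realType) (d : measure_display) (T : measurableType d)
    (P : probability T R) (eps : R -> {RV P >-> bool}) (lam a gam : bool -> R)
    (x : R) (X : R -> {RV P >-> R})
    (hmarkov : markov_property eps)
    (hhom : time_homogeneous eps)
    (hpaths : right_continuous_paths eps)
    (hint : switching_intensities eps lam)
    (hlam0 : 0 < lam false) (hlam1 : 0 < lam true)
    (hgam0 : 0 < gam false) (hgam1 : 0 < gam true)
    (hdrift : a true / gam true < a false / gam false)
    (hX : ou_solution eps a gam x X)
    (hx : a false / gam false < x) :
  let passage := fun w => first_passage_below (fun t => X t : T -> R)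
                            (a false / gam false) w in
  {ae P, forall w, (passage w < +oo)%E} /\
  (forall i : bool, (0 < P (at_state eps 0 i))%E ->
     condP P [set w | (passage w < +oo)%E] (at_state eps 0 i) = 1).
Proof.
move=> passage; set b := a false / gam false in hdrift hx passage *.
set c := gam true * b - a true.
have c0 : 0 < c by rewrite /c subr_gt0 mulrC -ltr_pdivrMr.
pose D := (x - b) / c + 1.
have D0 : 0 < D by rewrite addr_gt0// divr_gt0// subr_gt0.
have HD : x - b < c * D.
  by rewrite /D mulrDr mulr1 mulrCA divff ?gt_eqF// mulr1 ltrDl.
have ae : {ae P, forall w, (passage w < +oo)%E}.
  apply: filterS (ae_long_stay_true D hmarkov hhom hpaths hint hlam0 hlam1).
  move=> w [t0 t00 He]; apply/first_passage_lty.
  have [_ _ HX] := hX w.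
  exact: (crossing_of_long_stay hgam0 hgam1 hdrift HX t00 D0 He HD).
split=> // i Pi.
pose A := [set w | (passage w < +oo)%E].
have mA : measurable A.
  have -> : A = \bigcup_(r : rat) [set w | X `|ratr r : R| w < b].
    apply/seteqP; split=> w /=.
      move=> /first_passage_lty[t [t_ge0 Xt]].
      have [_ cX _] := hX w.
      have [r r0 Xr] := crossing_at_rational cX t_ge0 Xt.
      by exists r => //=; rewrite ger0_norm// ler0q.
    by move=> [r _ Xr]; apply/first_passage_lty; exists `|ratr r|.
  apply: bigcupT_measurable_rat => r.
  rewrite (_ : mkset _ = X `|ratr r : R| @^-1` `]-oo, b[); last first.
    by apply/seteqP; split=> w /=; rewrite in_itv.
  exact: measurable_funPTI.
have PA0 : P (~` A) = 0%E.
  by apply: measure_negligible => //; exact: measurableC.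
have mB := measurable_at_state eps 0 i.
have mAC := measurableC mA.
rewrite /condP setIC -/A; set B := at_state eps 0 i in Pi mB *.
have PBA : fine (P (B `&` ~` A)) = 0.
  by apply: (fine_prob_eq0 _ mAC _ PA0) => //; exact: measurableI.
have := fine_prob_setIC P mB mA; rewrite PBA addr0 => <-.
rewrite divff// gt_eqF// fine_gt0// Pi/=.
by rewrite ltey_eq fin_num_measure.
Qed.
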